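(* Let $n\geqslant p>1$ and $k\geqslant 1$ be integers with $n+p\geqslant k$, and let $K_{n,p}$ be the complete bipartite graph with parts of sizes $n$ and $p$. Then $$\gamma_{k\text{-SRD}}(K_{n,p})=\begin{cases}2k+2, & \text{if } k<p-1,\\ \min\{n,k\}+p, & \text{if } k\geqslant p-1.\end{cases}$$
   Context: All graphs are finite, simple and undirected; $N(v)$ denotes the set of neighbors of $v$ and $\Delta(G)$ the maximum degree. Let $k\geqslant 1$ be an integer with $|V(G)|\geqslant k$. An attack pattern is a set $P\subseteq V(G)$ with $|P|=k$. A function $f:V(G)\to\{0,1,\ldots,\min(\Delta(G),k)+1\}$ is a proper $k$-SRD ($k$-strong Roman domination) function if for each attack pattern $P$ every vertex $u\in P$ with $f(u)=0$ can be defended by a neighboring vertex, where each vertex $v$ with $f(v)\geqslant 2$ can defend at most $f(v)-1$ of its neighbors in $P$ labeled 0 (and vertices with label $\leqslant 1$ defend no other vertex). That is, for each $P$ there is a map $\delta_P:\{u\in P : f(u)=0\}\to V(G)$ (which may depend on $P$) such that $\delta_P(u)\in N(u)$ and $f(\delta_P(u))\geqslant 2$ for all $u$ in its domain, and $|\delta_P^{-1}(v)|\leqslant f(v)-1$ for every $v$ with $f(v)\geqslant 2$. The weight is $\omega(f)=\sum_{v\in V(G)}f(v)$, and the $k$-SRD number is $\gamma_{k\text{-SRD}}(G)=\min\{\omega(f) : f \text{ is a proper } k\text{-SRD function on } G\}$. *)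

(* Defs.v *)
From mathcomp Require Import all_boot.

Set Implicit Arguments.
Unset Strict Implicit.
Unset Printing Implicit Defensive.

Record sgraph := SGraph {
  vertex :> finType;
  edge : rel vertex;
  edge_sym : symmetric edge;
  edge_irrefl : irreflexive edge }.

Section StrongRoman.

Variables (G : sgraph) (k : nat).

Definition neighbors (v : G) : {set G} := [set u | edge v u].

Definition max_degree : nat := \max_(v : G) #|neighbors v|.

(* The labels are 0, 1, ..., min(Delta(G), k) + 1. *)
Definition labeling := {ffun G -> 'I_(minn max_degree k).+2}.

Implicit Types (f : labeling) (P : {set G}) (delta : {ffun G -> G}).

Definition attack_pattern P : bool := #|P| == k.

Definition attacked_zeros f P : {set G} := [set u in P | f u == 0 :> nat].

(* The map delta is total, but only its values on [attacked_zeros f P] matter. *)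
Definition defends f P delta : bool :=
  [forall u in attacked_zeros f P,
     (delta u \in neighbors u) && (2 <= f (delta u))] &&
  [forall (v | 2 <= f v),
     #|[set u in attacked_zeros f P | delta u == v]| <= f v - 1].

Definition proper_srd f : bool :=
  [forall (P | attack_pattern P), exists delta, defends f P delta].

Definition weight f : nat := \sum_(v : G) f v.

Lemma proper_srd_ex : exists w, [exists f, proper_srd f && (weight f == w)].
Proof.
pose f1 : labeling := [ffun=> inord 1].
have f1E v : f1 v = 1 :> nat by rewrite ffunE inordK.
exists (weight f1); apply/existsP; exists f1; rewrite eqxx andbT.
apply/forall_inP => P _; apply/existsP; exists [ffun v => v].
have U0 : attacked_zeros f1 P = set0.
  by apply/setP => u; rewrite !inE f1E andbF.
by apply/andP; split; apply/forall_inP => u; rewrite ?U0 ?inE ?f1E.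
Qed.

Definition srd_number : nat := ex_minn proper_srd_ex.

End StrongRoman.

Section CompleteBipartite.

Variables n p : nat.

Definition biclique_edge : rel ('I_n + 'I_p)%type := fun x y =>
  match x, y with
  | inl _, inr _ | inr _, inl _ => true
  | _, _ => false
  end.

Lemma biclique_edge_sym : symmetric biclique_edge.
Proof. by case=> ? []. Qed.

Lemma biclique_edge_irrefl : irreflexive biclique_edge.
Proof. by case. Qed.

Definition biclique : sgraph := SGraph biclique_edge_sym biclique_edge_irrefl.

End CompleteBipartite.

(* Main.v *)
(** Call [\sum_(v in T) (f v - 1)] the capacity of a set [T] of vertices: it bounds
    the number of attacked zeros that [T] can defend, and [T] weighs its capacity
    plus its number of nonzero labels.  In [K_{n,p}] each part is defended only by
    the other one, so if the parts have [a] and [b] zeros, then their capacities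
    are at least [min(k,b)] and [min(k,a)], and the weight is at least
    [(n - a) + min(k,b) + (p - b) + min(k,a)].  A part of positive capacity has a
    nonzero label, and minimizing over [a] and [b] gives the lower bound.  It is
    attained by one vertex labeled [k+1] in each part when [k < p - 1], and
    otherwise by zeros on the part of size [n], and ones on the other part except
    for a single label [min(n,k)+1]. *)

Require Import Defs.
From mathcomp Require Import all_boot.
From mathcomp Require Import zify.

Set Implicit Arguments.
Unset Strict Implicit.
Unset Printing Implicit Defensive.

(** This is used to pick a set of attacked zeros of prescribed size and to extend it to an attack
    pattern of exactly [k] vertices. *)
Lemma subset_between (T : finType) (A B : {set T}) (k : nat) :
  A \subset B -> #|A| <= k <= #|B| ->
  exists C : {set T}, [/\ A \subset C, C \subset B & #|C| = k].
Proof.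
move=> sAB /andP[leAk]; elim: k leAk => [|k IHk].
  by rewrite leqn0 => /eqP A0 _; exists A.
rewrite leq_eqVlt => /predU1P[<- _|]; first by exists A.
rewrite ltnS => leAk ltkB; have [C [sAC sCB Ck]] := IHk leAk (ltnW ltkB).
have /card_gt0P[x] : 0 < #|B :\: C| by rewrite cardsDS // Ck subn_gt0.
rewrite inE => /andP[xNC xB]; exists (x |: C).
by rewrite subUset sub1set xB (subset_trans sAC (subsetUr _ _)) cardsU1 xNC Ck.
Qed.

Section StrongRomanTheory.

Variables (G : sgraph) (k : nat).
Implicit Types (f : labeling G k) (S T : {set G}).

Definition zeros f S : {set G} := [set v in S | f v == 0 :> nat].
Definition capacity f S : nat := \sum_(v in S) (f v - 1).

(** Vertex by vertex, [f v + [f v = 0] = (f v - 1) + 1], because the truncated subtraction gives 0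
    at a zero label. *)
Lemma sum_label f S : \sum_(v in S) f v + #|zeros f S| = capacity f S + #|S|.
Proof.
have -> : #|zeros f S| = \sum_(v in S) (f v == 0 :> nat).
  rewrite -sum1_card; under eq_bigl do rewrite inE.
  by rewrite big_mkcondr; apply: eq_bigr => v _; case: eqP.
rewrite -[#|S|]sum1_card -!big_split /=.
by apply: eq_bigr => v _; case: (f v) => -[|m] /= _; lia.
Qed.

Lemma capacity_all_zeros f S : #|zeros f S| = #|S| -> capacity f S = 0.
Proof.
move=> eqZS; have /eqP ZS : zeros f S == S.
  by rewrite eqEcard eqZS leqnn andbT; apply/subsetP => v /[!inE] /andP[].
by apply: big1 => v; rewrite -ZS inE => /andP[_ /eqP->].
Qed.

(** Attack as many zeros of [S] as [k] allows: all their defenders lie in [T]. *)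
Lemma leq_zeros_capacity f S T : proper_srd f -> k <= #|G| ->
  {in S, forall u, neighbors u \subset T} ->
  minn k #|zeros f S| <= capacity f T.
Proof.
move=> /forall_inP propf lekG NST.
have [Z [_ ZS cardZ]] : exists Z : {set G},
    [/\ set0 \subset Z, Z \subset zeros f S & #|Z| = minn k #|zeros f S|].
  by apply: subset_between; rewrite ?sub0set ?cards0 ?geq_minr.
have [P [ZP _ cardP]] : exists P : {set G},
    [/\ Z \subset P, P \subset [set: G] & #|P| = k].
  by apply: subset_between; rewrite ?subsetT // cardZ geq_minl cardsT.
have /existsP[d /andP[/forall_inP dN /forall_inP dcap]] :
    [exists d, defends f P d] by apply: propf; rewrite /attack_pattern cardP.
have ZsP u : u \in Z -> u \in attacked_zeros f P.
  by move=> uZ; rewrite inE (subsetP ZP) //; have /[!inE]/andP[] := subsetP ZS _ uZ.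
have dZT u : u \in Z -> (d u \in T) && (2 <= f (d u)).
  move=> uZ; have /andP[dNu ->] := dN u (ZsP u uZ); rewrite andbT.
  by have /[!inE]/andP[/NST/subsetP-> //] := subsetP ZS _ uZ.
(* Count [Z] by the fibers of [d]; the fiber over [v] has at most [f v - 1] elements. *)
rewrite -cardZ -sum1_card (partition_big d (fun v => (v \in T) && (2 <= f v))) //=.
rewrite /capacity big_mkcondr /=; apply: leq_sum => v _; case: ifP => // f2.
apply: leq_trans (dcap v f2); rewrite sum1_card; apply: subset_leq_card.
by apply/subsetP => u /andP[/ZsP uP du]; rewrite inE uP.
Qed.

(** One map [d] serves all attack patterns: the attacked part of a fiber is bounded both by the
    fiber and by [k], the size of the pattern. *)
Lemma proper_srd_uniform f (d : G -> G) :
  (forall u, f u = 0 :> nat -> edge u (d u) /\ 2 <= f (d u)) ->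
  (forall v, 2 <= f v ->
     minn k #|[set u | (f u == 0 :> nat) && (d u == v)]| <= f v - 1) ->
  proper_srd f.
Proof.
move=> dN dcap; apply/forall_inP => P /eqP cardP; apply/existsP; exists (finfun d).
apply/andP; split; apply/forall_inP => v.
  by rewrite !inE ffunE => /andP[_ /eqP/dN[-> ->]].
move=> /dcap; apply: leq_trans; rewrite leq_min -[X in (_ <= X) && _]cardP.
apply/andP; split; apply: subset_leq_card; apply/subsetP => u.
  by rewrite !inE => /andP[/andP[]].
by rewrite !inE ffunE => /andP[/andP[_ ->]].
Qed.

Lemma srd_number_eq w :
  (exists2 f : labeling G k, proper_srd f & weight f = w) ->
  (forall f : labeling G k, proper_srd f -> w <= weight f) ->
  srd_number G k = w.
Proof.
move=> [f propf fw] w_min; rewrite /srd_number.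
case: ex_minnP => m /existsP[g /andP[/w_min lewg /eqP<-]] min_g.
apply/eqP; rewrite eqn_leq lewg andbT min_g //.
by apply/existsP; exists f; rewrite propf fw eqxx.
Qed.

End StrongRomanTheory.

Section Biclique.

Variables n p : nat.
Notation K := (biclique n p).

Definition left_part : {set K} := [set inl i | i in 'I_n].

Lemma in_left_part (v : K) : (v \in left_part) = (if v is inl _ then true else false).
Proof. by case: v => i; [rewrite imset_f | apply/imsetP => -[]]. Qed.

Lemma card_left_part : #|left_part| = n.
Proof. by rewrite card_imset ?card_ord //; apply: inl_inj. Qed.

Lemma card_biclique : #|K| = n + p.
Proof. by rewrite card_sum !card_ord. Qed.

Lemma card_left_partC : #|~: left_part| = p.
Proof. by rewrite cardsCs setCK card_biclique card_left_part addKn. Qed.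

(** This ensures that the large labels of the two constructions below are within the allowed
    range. *)
Lemma leq_max_degree_biclique : 0 < p -> n <= max_degree K.
Proof.
case: p => // q _; apply: leq_trans (leq_bigmax (inr ord0 : biclique n q.+1)).
rewrite -[X in X <= _](card_ord n) -(card_imset _ (@inl_inj 'I_n 'I_q.+1)).
by apply: subset_leq_card; apply/subsetP => _ /imsetP[i _ ->]; rewrite inE.
Qed.

(** Here [a] and [b] count the zeros of the two parts. The two implications hold because a part
    consisting of zeros has capacity 0. *)
Lemma weight_biclique_ge k (f : labeling K k) : proper_srd f -> k <= n + p ->
  exists a b, [/\ a <= n, b <= p,
    a = n -> minn k b = 0, b = p -> minn k a = 0 &
    (n - a) + minn k b + ((p - b) + minn k a) <= weight f].
Proof.
move=> propf lek; set A := left_part.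
have lekK : k <= #|K| by rewrite card_biclique.
have capB : minn k #|zeros f A| <= capacity f (~: A).
  apply: leq_zeros_capacity => // -[i _ | j]; last by rewrite in_left_part.
  by apply/subsetP => -[] ?; rewrite !inE in_left_part.
have capA : minn k #|zeros f (~: A)| <= capacity f A.
  apply: leq_zeros_capacity => // -[i | j _]; first by rewrite inE in_left_part.
  by apply/subsetP => -[] ?; rewrite !inE in_left_part.
have sumA := sum_label f A; have sumB := sum_label f (~: A).
have zA := @capacity_all_zeros _ _ f A; have zB := @capacity_all_zeros _ _ f (~: A).
have leA : #|zeros f A| <= #|A|.
  by apply: subset_leq_card; apply/subsetP => v /[!inE] /andP[].
have leB : #|zeros f (~: A)| <= #|~: A|.
  by apply: subset_leq_card; apply/subsetP => v; rewrite inE => /andP[].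
have -> : weight f = \sum_(v in A) f v + \sum_(v in ~: A) f v.
  by rewrite /weight (bigID [in A]) /=; congr (_ + _); apply: eq_bigl => v; rewrite inE.
rewrite card_left_part in sumA zA leA; rewrite card_left_partC in sumB zB leB.
by exists #|zeros f A|, #|zeros f (~: A)|; split=> //; lia.
Qed.

End Biclique.

Lemma proper_srd_star n p k : 0 < p -> 0 < k ->
  exists2 f : labeling (biclique n p) k, proper_srd f & weight f = minn n k + p.
Proof.
case: p => // q _ k_gt0; set K := biclique n q.+1.
pose g (v : K) : nat :=
  match v with inl _ => 0 | inr j => if j == ord0 then (minn n k).+1 else 1 end.
pose f : labeling K k := [ffun v => inord (g v)].
have fE v : f v = g v :> nat.
  rewrite ffunE inordK //; have := @leq_max_degree_biclique n q.+1 isT.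
  by rewrite -/K /g; case: v => [i|j]; [|case: ifP]; lia.
exists f.
  apply: (@proper_srd_uniform K k f (fun=> inr ord0)) => [[i|j]|v]; rewrite !fE /=.
  (* The vertex [i] witnesses [0 < n], so the label [minn n k + 1] is at least 2. *)
  - by have := ltn_ord i; lia.
  - by case: ifP.
  - case: v => [|j] //=; case: eqP => // -> _.
    rewrite subn1 /= minnC leq_min geq_minr andbT geq_min.
    rewrite -[X in _ <= X](card_left_part n q.+1) subset_leq_card //.
    apply/subsetP => u; rewrite inE fE in_left_part.
    by case: u => //= i; case: ifP.
rewrite /weight big_sumType /= big1 => [|i _]; last by rewrite fE.
rewrite big_ord_recl fE /= (eq_bigr (fun=> 1)) => [|j _]; last by rewrite fE.
by rewrite sum_nat_const card_ord; lia.
Qed.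

Lemma proper_srd_double_star n p k : 0 < p -> 0 < k <= n ->
  exists2 f : labeling (biclique n p) k, proper_srd f & weight f = 2 * k + 2.
Proof.
case: p => // q _; case: n => [|m] /andP[k_gt0 lekn]; first by lia.
set K := biclique m.+1 q.+1.
pose g (v : K) : nat :=
  match v with
  | inl i => if i == ord0 then k.+1 else 0
  | inr j => if j == ord0 then k.+1 else 0
  end.
pose f : labeling K k := [ffun v => inord (g v)].
have fE v : f v = g v :> nat.
  rewrite ffunE inordK //; have := @leq_max_degree_biclique m.+1 q.+1 isT.
  by rewrite -/K /g; case: v => [i|j]; case: ifP; lia.
exists f.
  (* Each zero is defended by the vertex labeled [k + 1] in the opposite part, which can answer any
     [k] attacks. *)
  pose d (v : K) : K := if v is inl _ then inr ord0 else inl ord0.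
  apply: (proper_srd_uniform (d := d)) => [[i|j] _|v]; rewrite ?fE //.
  by case: v => j /=; case: eqP => // _ _; rewrite subn1 geq_minl.
rewrite /weight big_sumType /= !big_ord_recl !fE /=.
by rewrite !big1 => [|j _|i _]; rewrite ?fE //; lia.
Qed.

Theorem theorem4 (n p k : nat) (lt1p : 1 < p) (lepn : p <= n)
    (k_gt0 : 1 <= k) (lek : k <= n + p) :
  srd_number (biclique n p) k =
    if k < p - 1 then 2 * k + 2 else minn n k + p.
Proof.
apply: srd_number_eq => [|f propf].
  by case: ifP => ltk; [apply: proper_srd_double_star | apply: proper_srd_star]; lia.
have [a [b [lean lebp a_n b_p]]] := weight_biclique_ge propf lek.
(* Regroup the bound as [(n - a + minn k a) + (p - b + minn k b)]. If [a < n] and [b < p], the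
   summands are at least [minn n (k + 1)] and [minn p (k + 1)]. If [a = n] then [b = 0], and the
   bound is [minn k n + p]; if [b = p] then [a = 0], and it is [n + minn k p]. *)
by apply: leq_trans; case: ifP => ltk; lia.
Qed.
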